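(* Let $q$ be a prime power, $n$ a positive integer and $\lambda\in\mathbb{F}_q$. If $\mathbb{F}_q^*$ contains an $n$-th root $\delta$ of $\lambda$ (i.e. $\delta^n=\lambda$), then every $\lambda$-constacyclic code of length $n$ over $\mathbb{F}_q$ is equivalent to a cyclic code of length $n$ over $\mathbb{F}_q$.
   Context: A linear code of length $n$ over $\mathbb{F}_q$ is a subspace of $\mathbb{F}_q^n$. For $\lambda\in\mathbb{F}_q^*$, a linear code $C\subseteq\mathbb{F}_q^n$ is $\lambda$-constacyclic if $(\lambda c_{n-1},c_0,\ldots,c_{n-2})\in C$ whenever $(c_0,\ldots,c_{n-1})\in C$; identifying $(c_0,\ldots,c_{n-1})$ with $c_0+c_1x+\cdots+c_{n-1}x^{n-1}$, these are the ideals of $\mathbb{F}_q[x]/\langle x^n-\lambda\rangle$. Cyclic means $1$-constacyclic. Two codes of length $n$ are equivalent if one is mapped onto the other by a monomial transformation of $\mathbb{F}_q^n$, i.e. a permutation of coordinates composed with multiplication of each coordinate by a nonzero scalar. It is not assumed that $n$ is coprime to $q$. *)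

(* Defs.v *)
From HB Require Import structures.
From mathcomp Require Import all_boot all_order all_algebra all_fingroup.

Set Implicit Arguments.
Unset Strict Implicit.
Unset Printing Implicit Defensive.

Import GRing.Theory.
Local Open Scope ring_scope.

(* (c_0, ..., c_{n-1}) |-> (lambda * c_{n-1}, c_0, ..., c_{n-2}); [ord_pred]
   is the cyclic predecessor on ['I_n], so it sends 0 to n - 1. *)
Definition constacyclic_shift (F : finFieldType) (n : nat) (lambda : F)
    (c : 'rV[F]_n) : 'rV[F]_n :=
  \row_(i < n) (if (i == 0 :> nat)%N then lambda * c 0 (ord_pred i)
                else c 0 (ord_pred i)).

Definition constacyclic (F : finFieldType) (n : nat) (lambda : F)
    (C : {vspace 'rV[F]_n}) : Prop :=
  forall c : 'rV[F]_n, c \in C -> constacyclic_shift lambda c \in C.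

Definition cyclic_code (F : finFieldType) (n : nat)
    (C : {vspace 'rV[F]_n}) : Prop :=
  constacyclic 1 C.

Definition monomial_transformation (F : finFieldType) (n : nat)
    (f : 'End('rV[F]_n)) : Prop :=
  exists (s : 'S_n) (a : 'I_n -> F),
    (forall i : 'I_n, a i != 0) /\
    (forall (c : 'rV[F]_n) (i : 'I_n), f c 0 i = a i * c 0 (s i)).

Definition equivalent_codes (F : finFieldType) (n : nat)
    (C D : {vspace 'rV[F]_n}) : Prop :=
  exists f : 'End('rV[F]_n), monomial_transformation f /\ (f @: C)%VS = D.

(* Main.v *)
Require Import Defs.
From mathcomp Require Import all_boot all_order all_algebra all_fingroup.

Import GRing.Theory.
Local Open Scope ring_scope.

(** If [delta ^+ n = lambda], then rescaling the variable, [x |-> delta x], is a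
    diagonal monomial transformation carrying [F[x]/(x^n - lambda)] to
    [F[x]/(x^n - 1)]; it intertwines the [lambda]-constacyclic shift with [delta]
    times the cyclic shift, and codes are stable under scalars. *)

Definition geometric_scaling (F : finFieldType) (n : nat) (delta : F) :
    'End('rV[F]_n) :=
  linfun (mulmxr (diag_mx (\row_(i < n) delta ^+ i))).

Lemma geometric_scalingE (F : finFieldType) (n : nat) (delta : F)
    (c : 'rV[F]_n) (i : 'I_n) :
  geometric_scaling F n delta c 0 i = delta ^+ i * c 0 i.
Proof. by rewrite lfunE /= mul_mx_diag !mxE mulrC. Qed.

(** Consecutive weights differ by a factor [delta], so away from position 0 the extra [delta] turns
    [delta ^+ (i - 1)] into [delta ^+ i]. At the wrap-around it turns the last weight
    [delta ^+ (n - 1)] into [delta ^+ n], exactly the constacyclic factor. *)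
Lemma geometric_scaling_shift (F : finFieldType) (n : nat) (delta : F)
    (c : 'rV[F]_n) :
  geometric_scaling F n delta (constacyclic_shift (delta ^+ n) c) =
  delta *: constacyclic_shift 1 (geometric_scaling F n delta c).
Proof.
apply/rowP => i; rewrite geometric_scalingE !mxE geometric_scalingE mul1r if_same.
have i_lt_n := ltn_ord i; have n_gt0 := leq_ltn_trans (leq0n i) i_lt_n.
rewrite mulrA -exprS; case: eqP => [i0|/eqP]; rewrite /= ?i0.
  by rewrite mul1r add0n modn_small ?prednK.
rewrite -lt0n => i_gt0; congr (_ ^+ _ * _).
by rewrite -subn1 addnC -addnBA // modnDl modn_small subn1 ?prednK // ltnW.
Qed.

Theorem proposition3p2 (F : finFieldType) (n : nat) (n_gt0 : (0 < n)%N)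
    (lambda : F)
    (lambda_root : exists delta : F, delta != 0 /\ delta ^+ n = lambda)
    (C : {vspace 'rV[F]_n}) (hC : constacyclic lambda C) :
  exists D : {vspace 'rV[F]_n}, cyclic_code D /\ equivalent_codes C D.
Proof.
have [delta [delta_neq0 def_lambda]] := lambda_root.
exists (geometric_scaling F n delta @: C)%VS; split; last first.
  exists (geometric_scaling F n delta); split=> //.
  exists 1%g, (fun i => delta ^+ i); split=> [i|c i]; first exact: expf_neq0.
  by rewrite geometric_scalingE perm1.
move=> _ /memv_imgP[c cC ->].
(* The cyclic shift of the image of [c] is [delta^-1] times the image of the [lambda]-constacyclic
   shift of [c], hence stays in the image of [C]. *)
rewrite -[constacyclic_shift 1 _](scalerK delta_neq0) -geometric_scaling_shift.
by rewrite def_lambda memvZ // memv_img // hC.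
Qed.
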